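(* Let $p,q$ be two positive prime integers with $p\neq q$ and $p>5$, and let $n$ be a positive integer. Then the generalized Fibonacci-Lucas quaternion $G^{p,q}_n=g^{p,q}_n+g^{p,q}_{n+1}i+g^{p,q}_{n+2}j+g^{p,q}_{n+3}k$ is a zero divisor in the quaternion ring $\mathbb{H}_{\mathbb{Z}_p}(-1,-1)$ if and only if there exists an integer $l\ge 0$ such that $n=\frac{(2l+1)z(p)-1}{2}-1$, where $z(p)$ is the entry point of $p$ in the Fibonacci sequence.
   Context: $(f_n)_{n\ge 0}$ is the Fibonacci sequence ($f_0=0$, $f_1=1$, $f_n=f_{n-1}+f_{n-2}$ for $n\ge2$) and $(l_n)_{n\ge 0}$ the Lucas sequence ($l_0=2$, $l_1=1$, $l_n=l_{n-1}+l_{n-2}$ for $n\ge2$). For integers $p,q$ the generalized Fibonacci-Lucas numbers are $g^{p,q}_{n+1}=p f_n+q\, l_{n+1}$, $n\ge 0$. For a prime $r$, the entry point $z(r)$ is the smallest positive integer $z$ with $r\mid f_z$; $\mathbb{Z}_r=\mathbb{Z}/r\mathbb{Z}$, and $\mathbb{H}_{\mathbb{Z}_r}(-1,-1)$ is the 4-dimensional associative unital $\mathbb{Z}_r$-algebra with basis $\{1,i,j,k\}$ and relations $i^2=j^2=-1$, $k=ij=-ji$. Integer coefficients are reduced modulo $r$. An element $x$ of a ring is a zero divisor if there is a nonzero $y$ with $xy=0$ or $yx=0$ (so $0$ counts as a zero divisor). *)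

(* Defs.v *)
From HB Require Import structures.
From mathcomp Require Import all_boot all_order all_algebra.
From mathcomp Require Import ring.

Set Implicit Arguments.
Unset Strict Implicit.
Unset Printing Implicit Defensive.

Import GRing.Theory.
Local Open Scope ring_scope.

Fixpoint fib (n : nat) : nat :=
  if n is m.+1 then if m is k.+1 then (fib m + fib k)%N else 1%N else 0%N.

Fixpoint lucas (n : nat) : nat :=
  if n is m.+1 then if m is k.+1 then (lucas m + lucas k)%N else 1%N else 2%N.

(* g^{p,q}_{n+1} = p f_n + q l_{n+1}; only indices n >= 1 are meaningful, the
   value at n = 0 is an artefact of 0.-1 = 0. *)
Definition gfl (p q : int) (n : nat) : int :=
  p * (fib n.-1)%:Z + q * (lucas n)%:Z.

(* The map (f_n, f_{n+1}) |-> (f_{n+1}, f_{n+2}) is a permutation of the finite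
   set F_r x F_r, hence (0, 1) is periodic. *)
Lemma entry_point_exists (r : nat) :
  prime r -> exists z, (0 < z)%N && (r %| fib z)%N.
Proof.
move=> r_pr; pose f (x : 'F_r * 'F_r) := (x.2, x.1 + x.2).
have f_inj : injective f.
  move=> [a b] [c d] fxy; have /= bd := congr1 fst fxy.
  by have /= := congr1 snd fxy; rewrite bd => /addIr ->.
have fE n : iter n f (0, 1) = ((fib n)%:R, (fib n.+1)%:R).
  elim: n => [//|n IHn]; rewrite iterS IHn /f /=.
  by congr (_, _); rewrite -natrD addnC.
exists (order f (0, 1)); rewrite order_gt0 /=.
have := iter_order f_inj (0, 1); rewrite fE => -[+ _].
by move/eqP; rewrite -(dvdn_pcharf (pchar_Fp r_pr)).
Qed.

Definition entry_point (r : nat) (r_pr : prime r) : nat :=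
  ex_minn (entry_point_exists r_pr).

(* H_R(a, b): the free R-module on 1, i, j, k with i^2 = a, j^2 = b and
   k = ij = -ji, whence k^2 = -ab, ik = aj = -ki and jk = -bi = -kj. *)
Record quaternion (R : comNzRingType) (a b : R) :=
  Quaternion { qre : R; qimi : R; qimj : R; qimk : R }.

Arguments Quaternion {R a b}.

Section QuaternionAlgebra.
Variables (R : comNzRingType) (a b : R).
Local Notation H := (quaternion a b).
Implicit Types (x y z : H) (c : R).

Definition quaternion_to_prod x := (qre x, qimi x, qimj x, qimk x).
Definition quaternion_of_prod (t : R * R * R * R) : H :=
  let: (x0, x1, x2, x3) := t in Quaternion x0 x1 x2 x3.

Lemma quaternion_to_prodK : cancel quaternion_to_prod quaternion_of_prod.
Proof. by case. Qed.

HB.instance Definition _ := Choice.copy H (can_type quaternion_to_prodK).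

Definition addq x y : H :=
  Quaternion (qre x + qre y) (qimi x + qimi y)
             (qimj x + qimj y) (qimk x + qimk y).

Definition oppq x : H :=
  Quaternion (- qre x) (- qimi x) (- qimj x) (- qimk x).

Definition mulq x y : H :=
  let: Quaternion x0 x1 x2 x3 := x in
  let: Quaternion y0 y1 y2 y3 := y in
  Quaternion
    (x0 * y0 + a * (x1 * y1) + b * (x2 * y2) - a * b * (x3 * y3))
    (x0 * y1 + x1 * y0 - b * (x2 * y3) + b * (x3 * y2))
    (x0 * y2 + x2 * y0 + a * (x1 * y3) - a * (x3 * y1))
    (x0 * y3 + x3 * y0 + x1 * y2 - x2 * y1).

Definition scaleq c x : H :=
  Quaternion (c * qre x) (c * qimi x) (c * qimj x) (c * qimk x).

Fact addqA : associative addq.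
Proof. by move=> x y z; rewrite /addq /= !addrA. Qed.

Fact addqC : commutative addq.
Proof. by move=> x y; congr Quaternion; rewrite addrC. Qed.

Fact add0q : left_id (Quaternion 0 0 0 0) addq.
Proof. by case=> *; rewrite /addq /= !add0r. Qed.

Fact addNq : left_inverse (Quaternion 0 0 0 0) oppq addq.
Proof. by move=> x; rewrite /addq /= !addNr. Qed.

HB.instance Definition _ :=
  GRing.isZmodule.Build H addqA addqC add0q addNq.

Fact mulqA : associative mulq.
Proof. by move=> [????] [????] [????]; congr Quaternion; ring. Qed.

Fact mul1q : left_id (Quaternion 1 0 0 0) mulq.
Proof. by move=> [????]; congr Quaternion; ring. Qed.

Fact mulq1 : right_id (Quaternion 1 0 0 0) mulq.
Proof. by move=> [????]; congr Quaternion; ring. Qed.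

Fact mulqDl : left_distributive mulq addq.
Proof. by move=> [????] [????] [????]; congr Quaternion => /=; ring. Qed.

Fact mulqDr : right_distributive mulq addq.
Proof. by move=> [????] [????] [????]; congr Quaternion => /=; ring. Qed.

Fact oneq_neq0 : Quaternion 1 0 0 0 != 0 :> H.
Proof. by apply/eqP => -[/eqP]; rewrite oner_eq0. Qed.

HB.instance Definition _ :=
  GRing.Zmodule_isNzRing.Build H mulqA mul1q mulq1 mulqDl mulqDr oneq_neq0.

Fact scaleqA c d x : scaleq c (scaleq d x) = scaleq (c * d) x.
Proof. by rewrite /scaleq /= !mulrA. Qed.

Fact scale1q : left_id 1 scaleq.
Proof. by case=> *; rewrite /scaleq /= !mul1r. Qed.

Fact scaleqDr : right_distributive scaleq +%R.
Proof. by move=> c x y; rewrite /scaleq /= !mulrDr. Qed.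

Fact scaleqDl x : {morph scaleq^~ x : c d / c + d}.
Proof. by move=> c d; rewrite /scaleq /= !mulrDl. Qed.

HB.instance Definition _ :=
  GRing.Zmodule_isLmodule.Build R H scaleqA scale1q scaleqDr scaleqDl.

Fact scaleqAl c x y : c *: (x * y) = c *: x * y.
Proof. by move: x y => [????] [????]; congr Quaternion => /=; ring. Qed.

HB.instance Definition _ := GRing.Lmodule_isLalgebra.Build R H scaleqAl.

Fact scaleqAr c x y : c *: (x * y) = x * (c *: y).
Proof. by move: x y => [????] [????]; congr Quaternion => /=; ring. Qed.

HB.instance Definition _ := GRing.Lalgebra_isAlgebra.Build R H scaleqAr.

Definition qi : H := Quaternion 0 1 0 0.
Definition qj : H := Quaternion 0 0 1 0.
Definition qk : H := Quaternion 0 0 0 1.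

Lemma qi_sqr : qi * qi = a%:A.
Proof. by congr Quaternion => /=; ring. Qed.

Lemma qj_sqr : qj * qj = b%:A.
Proof. by congr Quaternion => /=; ring. Qed.

Lemma qij : qi * qj = qk.
Proof. by congr Quaternion => /=; ring. Qed.

Lemma qji : qj * qi = - qk.
Proof. by congr Quaternion => /=; ring. Qed.

Lemma quaternionE (x0 x1 x2 x3 : R) :
  x0%:A + x1 *: qi + x2 *: qj + x3 *: qk = Quaternion x0 x1 x2 x3 :> H.
Proof. by congr Quaternion => /=; ring. Qed.

(* G^{p,q}_n with its integer coefficients mapped into R. *)
Definition gfl_quaternion (p q : int) (n : nat) : H :=
  (gfl p q n)%:~R%:A + (gfl p q n.+1)%:~R *: qi
  + (gfl p q n.+2)%:~R *: qj + (gfl p q n.+3)%:~R *: qk.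

End QuaternionAlgebra.

Arguments gfl_quaternion {R} a b p q n.

(* 0 is a zero divisor in a nontrivial ring. *)
Definition zero_divisor (A : nzRingType) (x : A) : Prop :=
  exists2 y : A, y != 0 & x * y = 0 \/ y * x = 0.

(* Main.v *)
Require Import Defs.
From mathcomp Require Import all_boot all_order all_algebra.
From mathcomp Require Import ring lra zify.

Set Implicit Arguments.
Unset Strict Implicit.
Unset Printing Implicit Defensive.

Import GRing.Theory.
Local Open Scope ring_scope.

(** Over a field, x times its conjugate is the scalar N(x), so x is a zero
    divisor exactly when N(x) = 0 ([zero_divisor_qnorm]): this is where the
    multiplication of the quaternions enters, and only the norm matters
    afterwards.

    Modulo p the summand p f_(n-1) of g_n vanishes and g_n becomes q l_n, so
    the norm of G_n is q^2 (l_n^2 + l_(n+1)^2 + l_(n+2)^2 + l_(n+3)^2).  Writing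
    the Lucas numbers through f_n and f_(n+1) turns this sum of squares into
    15 f_(2n+3) ([sum_sqr_lucas]).  As p > 5 and p <> q, the factor 15 q^2 is
    invertible modulo p, and G_n is a zero divisor iff p divides f_(2n+3).

    By the addition formula, multiplication by the unit f_(z+1) shifts the
    sequence modulo p by z = z(p), so p divides f_m iff z divides m
    ([dvdn_fib_entry_point]).  Finally 2n+3 is odd, so if z divides it the
    quotient is an odd number 2l+1, and 2n+3 = (2l+1) z is the stated formula
    for n. *)

(** * Fibonacci and Lucas numbers *)

Lemma fibSS n : fib n.+2 = (fib n.+1 + fib n)%N.
Proof. by []. Qed.

Lemma lucasSS n : lucas n.+2 = (lucas n.+1 + lucas n)%N.
Proof. by []. Qed.

Lemma fib_addS m n :
  fib (m + n).+1 = (fib m.+1 * fib n.+1 + fib m * fib n)%N.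
Proof.
elim: m n => [|m IHm] n; first by rewrite add0n mul1n mul0n addn0.
by rewrite addSnnS IHm !fibSS; ring.
Qed.

Lemma coprime_fibS n : coprime (fib n) (fib n.+1).
Proof.
elim: n => [//|n IHn].
by rewrite fibSS coprime_sym /coprime gcdnC gcdnDl gcdnC.
Qed.

Lemma lucas_fib n : (lucas n + fib n = 2 * fib n.+1)%N.
Proof.
suff: (lucas n + fib n = 2 * fib n.+1 /\
       lucas n.+1 + fib n.+1 = 2 * fib n.+2)%N by case.
elim: n => [//|n [IHn IHSn]]; split=> //.
by rewrite lucasSS (fibSS n.+1) mulnDr -IHn -IHSn fibSS; ring.
Qed.

(** With a = f_n and b = f_(n+1), the four Lucas numbers are 2b - a, 2a + b,
    a + 3b and 3a + 4b; the squares add up to 15 ((a + b)^2 + b^2), and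
    f_(2n+3) = f_(n+2)^2 + f_(n+1)^2. *)
Lemma sum_sqr_lucas n :
  (lucas n ^ 2 + lucas n.+1 ^ 2 + lucas n.+2 ^ 2 + lucas n.+3 ^ 2
   = 15 * fib (2 * n + 3))%N.
Proof.
have -> : (2 * n + 3 = (n.+1 + n.+1).+1)%N by lia.
rewrite fib_addS.
move: (lucas_fib n) (lucas_fib n.+1); rewrite !lucasSS !fibSS.
move: (fib n) (fib n.+1) (lucas n) (lucas n.+1) => a b u v Eu Ev.
(* The subtraction 2b - a forces the computation into the integers. *)
have {}Eu : u%:Z = 2 * b%:Z - a%:Z by lia.
have {}Ev : v = (2 * a + b)%N by lia.
apply/eqP; rewrite -(Num.Theory.eqr_nat int) Ev !(natrD, natrM, natrX).
by apply/eqP; rewrite !natz Eu; ring.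
Qed.

(** * The entry point *)

Section EntryPoint.
Variables (r : nat) (r_pr : prime r).
Local Notation z := (entry_point r_pr).

Lemma entry_point_gt0 : (0 < z)%N.
Proof. by rewrite /entry_point; case: ex_minnP => m /andP[]. Qed.

Lemma dvdn_fib_at_entry_point : (r %| fib z)%N.
Proof. by rewrite /entry_point; case: ex_minnP => m /andP[]. Qed.

Lemma entry_point_min m : (0 < m)%N -> (r %| fib m)%N -> (z <= m)%N.
Proof.
move=> m_gt0 r_fm; rewrite /entry_point; case: ex_minnP => k _; apply.
by rewrite m_gt0.
Qed.

(** Modulo r, f_(z+m) is f_(z+1) f_m, and r does not divide f_(z+1) since
    consecutive Fibonacci numbers are coprime. *)
Lemma dvdn_fib_entry_pointD m : (r %| fib (z + m))%N = (r %| fib m)%N.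
Proof.
case: m => [|m]; first by rewrite addn0 dvdn_fib_at_entry_point dvdn0.
rewrite addnS fib_addS dvdn_addl; last first.
  exact/dvdn_mulr/dvdn_fib_at_entry_point.
rewrite Gauss_dvdr //.
exact: coprime_dvdl dvdn_fib_at_entry_point (coprime_fibS z).
Qed.

Lemma dvdn_fib_entry_point m : (r %| fib m)%N = (z %| m)%N.
Proof.
have fib_mod k s : (r %| fib (k * z + s))%N = (r %| fib s)%N.
  by elim: k => // k IHk; rewrite mulSn -addnA dvdn_fib_entry_pointD.
rewrite {1}(divn_eq m z) fib_mod /dvdn -/(dvdn r _).
have [->|mz_neq0] := eqVneq (m %% z)%N 0%N; first exact: dvdn0.
apply/negP => /(entry_point_min _); rewrite lt0n mz_neq0 => /(_ isT).
by rewrite leqNgt ltn_pmod ?entry_point_gt0.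
Qed.

End EntryPoint.

(** * The norm of a quaternion *)

Section Norm.
Variables (F : fieldType) (a b : F).
Local Notation H := (quaternion a b).
Implicit Types x y : H.

Definition conjq x : H :=
  Quaternion (qre x) (- qimi x) (- qimj x) (- qimk x).

Definition qnorm x : F :=
  qre x ^+ 2 - a * qimi x ^+ 2 - b * qimj x ^+ 2 + a * b * qimk x ^+ 2.

Lemma mulq_conj x : x * conjq x = (qnorm x)%:A.
Proof. by case: x => *; congr Quaternion; rewrite /qnorm /=; ring. Qed.

Lemma mul_conjq x : conjq x * x = (qnorm x)%:A.
Proof. by case: x => *; congr Quaternion; rewrite /qnorm /=; ring. Qed.

Lemma conjqK : involutive conjq.
Proof. by case=> *; rewrite /conjq /= !opprK. Qed.

Lemma conjq_eq0 x : (conjq x == 0) = (x == 0).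
Proof.
have conjq0 : conjq 0 = 0 by congr Quaternion; rewrite /= oppr0.
by rewrite -{1}conjq0 (can_eq conjqK).
Qed.

(** A nonzero norm makes the conjugate, up to a scalar, a two-sided inverse;
    when the norm is zero, the conjugate is the annihilating element, unless
    x = 0, which 1 annihilates. *)
Lemma zero_divisor_qnorm x : zero_divisor x <-> qnorm x = 0.
Proof.
split=> [[y y_neq0 xy0] | Nx0].
  apply/eqP/negPn/negP => Nx_neq0; case/eqP: y_neq0.
  apply: (scalerI Nx_neq0); rewrite scaler0.
  case: xy0 => [xy0 | yx0].
    by rewrite -mulr_algl -mul_conjq -mulrA xy0 mulr0.
  by rewrite -mulr_algr -mulq_conj mulrA yx0 mul0r.
have [->|x_neq0] := eqVneq x 0.
  by exists 1; [exact: oner_neq0 | left; rewrite mul0r].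
exists (conjq x); first by rewrite conjq_eq0.
by left; rewrite mulq_conj Nx0 scale0r.
Qed.

End Norm.

(** * Generalized Fibonacci-Lucas quaternions modulo p *)

Lemma gfl_pchar (R : comNzRingType) (p q n : nat) :
  p \in [pchar R] -> (gfl p%:Z q%:Z n)%:~R = (q * lucas n)%:R :> R.
Proof.
move=> pR; rewrite /gfl rmorphD !rmorphM /= -!pmulrn (pcharf0 pR).
by rewrite mul0r add0r.
Qed.

Lemma qnorm_gfl_quaternion (F : fieldType) (p q n : nat) :
  p \in [pchar F] ->
  qnorm (gfl_quaternion (-1 : F) (-1 : F) p%:Z q%:Z n)
  = (q ^ 2 * (15 * fib (2 * n + 3)))%:R.
Proof.
move=> pF; rewrite /gfl_quaternion quaternionE /qnorm /= !gfl_pchar //.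
by rewrite -sum_sqr_lucas !(natrM, natrD, natrX); ring.
Qed.

(** Clearing denominators turns the formula for n into 2n+3 = (2l+1) z; since
    2n+3 is odd, so is every quotient of it, hence the shape 2l+1. *)
Lemma dvdn_double_add3P (z n : nat) :
  (z %| 2 * n + 3)%N <->
  exists l : nat, n%:R = ((2 * l%:R + 1) * z%:R - 1) / 2 - 1 :> rat.
Proof.
have natE l : n%:R = ((2 * l%:R + 1) * z%:R - 1) / 2 - 1 :> rat <->
              (2 * n + 3 = (2 * l + 1) * z)%N.
  have eq_rat : (2 * n + 3 = (2 * l + 1) * z)%N <->
      2 * n%:R + 3 = (2 * l%:R + 1) * z%:R :> rat.
    have -> : 2 * n%:R + 3 = (2 * n + 3)%:R :> rat by rewrite natrD natrM.
    have -> : (2 * l%:R + 1) * z%:R = ((2 * l + 1) * z)%:R :> rat.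
      by rewrite natrM natrD natrM.
    by split=> [-> // | /eqP]; rewrite Num.Theory.eqr_nat => /eqP.
  by rewrite eq_rat; split=> E; lra.
split=> [/dvdnP[k Ek] | [l /natE ->]]; last exact: dvdn_mull.
have k_odd : odd k.
  by have := congr1 odd Ek; rewrite oddD !oddM /=; case: (odd k).
exists k./2; apply/natE; rewrite Ek -{1}(odd_double_half k) k_odd.
by rewrite addnC -mul2n.
Qed.

Theorem theorem3p1 (p q n : nat) (p_pr : prime p) (q_pr : prime q)
    (p_neq_q : p <> q) (p_gt5 : (5 < p)%N) (n_gt0 : (0 < n)%N) :
  zero_divisor (gfl_quaternion (-1 : 'F_p) (-1 : 'F_p) p%:Z q%:Z n) <->
  exists l : nat,
    n%:R = ((2 * l%:R + 1) * (entry_point p_pr)%:R - 1) / 2 - 1 :> rat.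
Proof.
have pF := pchar_Fp p_pr.
have p_ndvd_q2 : ~~ (p %| q ^ 2)%N.
  by rewrite Euclid_dvdX // andbT dvdn_prime2 //; apply/eqP.
have p_ndvd_15 : ~~ (p %| 15)%N.
  rewrite (_ : 15 = 3 * 5)%N // Euclid_dvdM // negb_or.
  by rewrite !gtnNdvd // (leq_trans _ p_gt5).
rewrite -dvdn_double_add3P zero_divisor_qnorm qnorm_gfl_quaternion //.
rewrite -dvdn_fib_entry_point.
have -> : (p %| fib (2 * n + 3))%N
        = ((q ^ 2 * (15 * fib (2 * n + 3)))%:R == 0 :> 'F_p).
  rewrite -(dvdn_pcharf pF) Euclid_dvdM // (negPf p_ndvd_q2) /=.
  by rewrite Euclid_dvdM // (negPf p_ndvd_15).
by split=> /eqP.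
Qed.
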